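(* Let $A$ be an integral domain, and endow $\mathrm{Over}(A)$ and $\mathrm{SStar}_f(A)$ with their Zariski topologies. Then the natural map $\phi:\mathrm{Over}(A)\to\mathrm{SStar}_f(A)$, $D\mapsto\wedge_{\{D\}}$, is a topological embedding (i.e. a homeomorphism onto its image with the subspace topology).
   Context: Let $A$ be an integral domain with quotient field $K$. $\overline{\mathbf F}(A)$ is the set of all nonzero $A$-submodules of $K$, and $\mathbf f(A)$ is the set of all nonzero finitely generated fractional ideals of $A$ (nonzero finitely generated $A$-submodules of $K$). A semistar operation on $A$ is a map $\star:\overline{\mathbf F}(A)\to\overline{\mathbf F}(A)$, $F\mapsto F^\star$, such that for all nonzero $k\in K$ and all $F,G\in\overline{\mathbf F}(A)$: $(kF)^\star=kF^\star$; $F\subseteq G$ implies $F^\star\subseteq G^\star$; $F\subseteq F^\star$; $(F^\star)^\star=F^\star$. $\mathrm{SStar}(A)$ is the set of all semistar operations on $A$. The Zariski topology on $\mathrm{SStar}(A)$ is the topology having as a subbasis of open sets the sets $V_F:=\{\star\in\mathrm{SStar}(A):1\in F^\star\}$, for $F\in\overline{\mathbf F}(A)$. A semistar operation $\star$ is of finite type if $F^\star=\bigcup\{G^\star:G\in\mathbf f(A),\,G\subseteq F\}$ for every $F\in\overline{\mathbf F}(A)$. $\mathrm{SStar}_f(A)$ is the set of semistar operations of finite type on $A$, and its Zariski topology is the subspace topology from $\mathrm{SStar}(A)$. An overring of $A$ is a ring $B$ with $A\subseteq B\subseteq K$; $\mathrm{Over}(A)$ is the set of all overrings of $A$. The Zariski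 topology on $\mathrm{Over}(A)$ has as basic open sets the sets $B_F:=\{C\in\mathrm{Over}(A):F\subseteq C\}$, where $F$ ranges over the finite subsets of $K$. For $D\in\mathrm{Over}(A)$, $\wedge_{\{D\}}$ is the semistar operation (of finite type) on $A$ defined by $F\mapsto FD$ for $F\in\overline{\mathbf F}(A)$. *)

(* Defs.v *)
From HB Require Import structures.
From mathcomp Require Import all_boot all_order all_algebra.
From mathcomp Require Import all_classical.
From mathcomp Require Import all_reals topology.

Set Implicit Arguments.
Unset Strict Implicit.
Unset Printing Implicit Defensive.

Import GRing.Theory.

Local Open Scope classical_set_scope.
Local Open Scope ring_scope.

Section TopologicalEmbedding.
Variables X Y : topologicalType.

Definition homeomorphism (f : X -> Y) : Prop :=
  continuous f /\ exists g : Y -> X, [/\ continuous g, cancel f g & cancel g f].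

(* The type [range f] (that is, [set_type (range f)]) carries the subspace
   topology inherited from [Y]. *)
Definition to_range (f : X -> Y) (x : X) : range f :=
  exist _ (f x) (mem_set (imageT f x)).

End TopologicalEmbedding.

Definition topological_embedding (X Y : topologicalType) (f : X -> Y) : Prop :=
  homeomorphism (to_range f).

Section FractionSubmodules.
Variable A : idomainType.
Local Notation K := {fraction A}.
Local Notation toK := (@FracField.tofrac A).

Definition submodule (F : set K) : Prop :=
  [/\ F 0,
      forall x y, F x -> F y -> F (x + y) &
      forall (a : A) x, F x -> F (toK a * x)].

Definition nonzero (F : set K) : Prop := exists2 x, F x & x != 0.

Record Fbar : Type := MkFbar {
  Fbar_set :> set K;
  Fbar_submodule : submodule Fbar_set;
  Fbar_nonzero : nonzero Fbar_set
}.

Lemma Fbar_eq (F G : Fbar) : F = G :> set K -> F = G.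
Proof.
case: F G => [F sF nF] [G sG nG] /= eFG; move: sF nF sG nG; rewrite eFG => *.
by congr MkFbar; exact: Prop_irrelevance.
Qed.

Definition finitely_generated (F : set K) : Prop :=
  exists (n : nat) (g : 'I_n -> K),
    F = [set x | exists a : 'I_n -> A, x = \sum_(i < n) toK (a i) * g i].

Definition fg_ideal : set Fbar := [set F | finitely_generated F].

Definition scale_set (k : K) (F : set K) : set K := [set k * x | x in F].

Lemma scale_submodule k (F : Fbar) : submodule (scale_set k F).
Proof.
have [F0 FD FZ] := Fbar_submodule F; split.
- by exists 0; rewrite ?mulr0.
- by move=> _ _ [x Fx <-] [y Fy <-]; exists (x + y); [exact: FD|rewrite mulrDr].
- by move=> a _ [x Fx <-]; exists (toK a * x); [exact: FZ|rewrite mulrCA].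
Qed.

Lemma scale_nonzero k (F : Fbar) : k != 0 -> nonzero (scale_set k F).
Proof.
move=> k0; have [x Fx x0] := Fbar_nonzero F.
by exists (k * x); [exists x|rewrite mulf_neq0].
Qed.

Definition scaleF (k : K) (k0 : k != 0) (F : Fbar) : Fbar :=
  MkFbar (scale_submodule k F) (scale_nonzero F k0).

End FractionSubmodules.

Section SemistarOperations.
Variable A : idomainType.
Local Notation K := {fraction A}.

Record SStar : Type := MkSStar {
  star :> Fbar A -> Fbar A;
  star_scale : forall (k : K) (k0 : k != 0) F,
    star (scaleF k0 F) = scaleF k0 (star F);
  star_mono : forall F G : Fbar A, F `<=` G -> star F `<=` star G;
  star_ext : forall F : Fbar A, F `<=` star F;
  star_idem : forall F, star (star F) = star F
}.

Lemma SStar_eq (s t : SStar) : s =1 t -> s = t.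
Proof.
case: s t => [s s1 s2 s3 s4] [t t1 t2 t3 t4] /= /funext est.
move: s1 s2 s3 s4 t1 t2 t3 t4; rewrite est => *.
by congr MkSStar; exact: Prop_irrelevance.
Qed.

Definition Zariski_V (F : Fbar A) : set SStar := [set s : SStar | Fbar_set (s F) 1].

HB.instance Definition _ := gen_eqMixin SStar.
HB.instance Definition _ := gen_choiceMixin SStar.
HB.instance Definition _ := isSubBaseTopological.Build SStar
  (range Zariski_V) (@id (set SStar)).

Definition finite_type (s : SStar) : Prop := forall F : Fbar A,
  s F = \bigcup_(G in [set G | fg_ideal G /\ G `<=` F]) s G :> set K.

(* As a type, [SStarf A] is [set_type (SStarf A)], with its subspace topology. *)
Definition SStarf : set SStar := [set s | finite_type s].

End SemistarOperations.

Arguments SStarf A : clear implicits.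

Section Overrings.
Variable A : idomainType.
Local Notation K := {fraction A}.
Local Notation toK := (@FracField.tofrac A).

(* [Over_base] also gives that [0] and [1] belong to an overring. *)
Record Over : Type := MkOver {
  Over_set :> set K;
  Over_base : forall a : A, Over_set (toK a);
  Over_sub : forall x y, Over_set x -> Over_set y -> Over_set (x - y);
  Over_mul : forall x y, Over_set x -> Over_set y -> Over_set (x * y)
}.

Lemma Over_eq (B C : Over) : B = C :> set K -> B = C.
Proof.
case: B C => [B b1 b2 b3] [C c1 c2 c3] /= eBC.
move: b1 b2 b3 c1 c2 c3; rewrite eBC => *.
by congr MkOver; exact: Prop_irrelevance.
Qed.

Definition Zariski_B (F : set K) : set Over := [set C : Over | F `<=` C].

Let basic := [set Zariski_B F | F in [set F | finite_set F]].

Let basic_cover : \bigcup_(U in basic) id U = setT.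
Proof.
apply/seteqP; split=> // C _; exists (Zariski_B set0); last exact: sub0set.
by exists set0 => //; exact: finite_set0.
Qed.

Let basic_join U V C : basic U -> basic V -> id U C -> id V C ->
  exists W, [/\ basic W, id W C & id W `<=` id U `&` id V].
Proof.
move=> [F fF <-] [G fG <-] FC GC; exists (Zariski_B (F `|` G)); split.
- by exists (F `|` G) => //=; rewrite finite_setU.
- by rewrite /Zariski_B /= subUset.
- by move=> D /=; rewrite /Zariski_B /= subUset.
Qed.

HB.instance Definition _ := gen_eqMixin Over.
HB.instance Definition _ := gen_choiceMixin Over.
HB.instance Definition _ :=
  isBaseTopological.Build Over basic_cover basic_join.

Definition prod_set (F D : set K) : set K :=
  [set x | exists (n : nat) (f d : 'I_n -> K),
     [/\ forall i, F (f i), forall i, D (d i) & x = \sum_(i < n) f i * d i]].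

Section Extension.
Variable D : Over.

Lemma Over1 : Over_set D 1. Proof. by rewrite -(rmorph1 toK); exact: Over_base. Qed.

Lemma prod_set_incl (F : set K) : F `<=` prod_set F D.
Proof.
move=> x Fx; exists 1%N, (fun=> x), (fun=> 1).
by split=> // [_|]; [exact: Over1|rewrite big_ord1 mulr1].
Qed.

Lemma prod_setM (F : set K) x d : F x -> Over_set D d -> prod_set F D (x * d).
Proof. by move=> Fx Dd; exists 1%N, (fun=> x), (fun=> d); rewrite big_ord1. Qed.

Lemma prod_set0 (F : set K) : prod_set F D 0.
Proof.
by exists 0%N, (fun=> 0), (fun=> 0); split; [case|case|rewrite big_ord0].
Qed.

Lemma prod_setD (F : set K) x y :
  prod_set F D x -> prod_set F D y -> prod_set F D (x + y).
Proof.
move=> [m [f [d [Ff Dd ->]]]] [n [g [e [Fg De ->]]]].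
exists (m + n)%N, (fun i : 'I_(m + n) => match fintype.split i with inl j => f j | inr j => g j end),
  (fun i : 'I_(m + n) => match fintype.split i with inl j => d j | inr j => e j end).
split=> [i|i|]; [by case: fintype.split|by case: fintype.split|].
rewrite big_split_ord /=; congr (_ + _); apply: eq_bigr => i _.
- by rewrite (unsplitK (inl i)).
- by rewrite (unsplitK (inr i)).
Qed.

Lemma prod_set_mulr (F : set K) x d :
  prod_set F D x -> Over_set D d -> prod_set F D (x * d).
Proof.
move=> [m [f [e [Ff De ->]]]] Dd; exists m, f, (fun i => e i * d).
split=> // [i|]; first exact: Over_mul.
by rewrite mulr_suml; apply: eq_bigr => i _; rewrite mulrA.
Qed.

Lemma prod_submodule (F : set K) : submodule (prod_set F D).
Proof.
split; [exact: prod_set0|exact: prod_setD|move=> a x Fx].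
by rewrite mulrC; apply: prod_set_mulr => //; exact: Over_base.
Qed.

Lemma prod_nonzero (F : Fbar A) : nonzero (prod_set F D).
Proof.
by have [x Fx x0] := Fbar_nonzero F; exists x => //; exact: prod_set_incl.
Qed.

Definition prodF (F : Fbar A) : Fbar A :=
  MkFbar (prod_submodule F) (prod_nonzero F).

Lemma prodF_scale k (k0 : k != 0) F : prodF (scaleF k0 F) = scaleF k0 (prodF F).
Proof.
apply: Fbar_eq; apply/seteqP; split=> x /=.
- move=> [n [f [d [kFf Dd ->]]]].
  have /choice [g gP] i : exists y, Fbar_set F y /\ k * y = f i.
    by have [y ? <-] := kFf i; exists y.
  exists (\sum_(i < n) g i * d i).
    by exists n, g, d; split=> // i; have [] := gP i.
  by rewrite mulr_sumr; apply: eq_bigr => i _; have [_ <-] := gP i; rewrite mulrA.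
- move=> [_ [n [f [d [Ff Dd ->]]]] <-]; exists n, (fun i => k * f i), d.
  split=> // [i|]; first by exists (f i).
  by rewrite mulr_sumr; apply: eq_bigr => i _; rewrite mulrA.
Qed.

Lemma prodF_mono (F G : Fbar A) : F `<=` G -> prodF F `<=` prodF G.
Proof.
move=> FG x [n [f [d [Ff Dd ->]]]]; exists n, f, d.
by split=> // i; exact: FG.
Qed.

Lemma prodF_idem F : prodF (prodF F) = prodF F.
Proof.
apply: Fbar_eq; apply/seteqP; split; last exact: (@prod_set_incl (prodF F)).
move=> x [n [f [d [Ff Dd ->]]]].
elim/big_ind: _ => [|y z|i _]; [exact: prod_set0|exact: prod_setD|].
exact: (@prod_set_mulr F _ _ (Ff i) (Dd i)).
Qed.

Definition wedge : SStar A :=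
  MkSStar prodF_scale prodF_mono (fun F => @prod_set_incl F) prodF_idem.

Lemma wedge_finite_type : finite_type wedge.
Proof.
move=> F; apply/seteqP; split; last first.
  by move=> x [G [_ GF]]; exact: prodF_mono.
move=> x [n [f [d [Ff Dd ->]]]]; have [u Fu u0] := Fbar_nonzero F.
have [F0 FD FZ] := Fbar_submodule F.
(* [u] is added to the generators, as all the [f i] could vanish. *)
pose g (i : 'I_n.+1) := if unlift ord0 i is Some j then f j else u.
pose G := [set x | exists a : 'I_n.+1 -> A, x = \sum_(i < n.+1) toK (a i) * g i].
have Gg i : G (g i).
  exists (fun j => (i == j)%:R); rewrite (bigD1 i) //= eqxx rmorph1 mul1r.
  rewrite big1 ?addr0 // => j; rewrite eq_sym => /negPf ->.
  by rewrite rmorph0 mul0r.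
have Gsub : submodule G.
  split.
  - by exists (fun=> 0); rewrite big1 // => i _; rewrite rmorph0 mul0r.
  - move=> _ _ [a ->] [b ->]; exists (fun i => a i + b i).
    by rewrite -big_split; apply: eq_bigr => i _; rewrite rmorphD mulrDl.
  - move=> c _ [a ->]; exists (fun i => c * a i).
    by rewrite mulr_sumr; apply: eq_bigr => i _; rewrite rmorphM mulrA.
have Gnz : nonzero G by exists u => //; have := Gg ord0; rewrite /g unlift_none.
exists (MkFbar Gsub Gnz); last first.
  exists n, f, d; split=> // i.
  by have := Gg (lift ord0 i); rewrite /g liftK.
split; first by exists n.+1, g.
move=> _ [a ->]; elim/big_ind: _ => [//|y z|i _]; first exact: FD.
by apply: FZ; rewrite /g; case: unlift.
Qed.

End Extension.

Definition phi (D : Over) : SStarf A :=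
  exist _ (wedge D) (mem_set (@wedge_finite_type D)).

End Overrings.

(* Main.v *)
Require Import Defs.
From mathcomp Require Import all_boot all_order all_algebra finmap.
From mathcomp Require Import all_classical all_reals topology.

(** Write F D for the semistar operation of an overring D applied to F.

    Continuity. If 1 lies in F D, then 1 is a finite sum of products f_i d_i
    with f_i in F and d_i in D, and the same equation puts 1 in F C for every
    overring C containing the d_i. Those C form a basic open neighbourhood of
    D, so the preimage of each subbasic open set V_F is open ([open_wedge_V]).

    Openness onto the image. A nonzero x belongs to D exactly when 1 belongs to
    (x^-1 A) D, that is, when the semistar operation of D lies in V_F for the
    principal fractional ideal F = x^-1 A ([wedge_principalV]). So D can be read
    off from its semistar operation, which is injectivity, and the set of
    overrings containing a given x corresponds to the trace of a subbasic open
    set on the image. A basic open set of overrings is a finite intersection of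
    sets of that form, so the inverse map is continuous. *)

Set Implicit Arguments.
Unset Strict Implicit.
Unset Printing Implicit Defensive.

Import GRing.Theory.

Local Open Scope classical_set_scope.
Local Open Scope ring_scope.

Lemma open_bigcap_finite (T : topologicalType) (I : choiceType)
    (D : set I) (B : I -> set T) :
  finite_set D -> (forall i, D i -> open (B i)) -> open (\bigcap_(i in D) B i).
Proof.
move=> finD oB; rewrite -closedC setC_bigcap; apply: closed_bigcup => // i Di.
by rewrite closedC; exact: oB.
Qed.

Lemma continuous_to_set_type (X Y : topologicalType) (S : set Y) (f : X -> S) :
  continuous (set_val \o f : X -> Y) -> continuous f.
Proof.
move=> /continuousP cf; apply/continuousP => _ [V oV <-].
exact: cf.
Qed.

Section ZariskiTopologies.
Variable A : idomainType.
Local Notation K := {fraction A}.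
Local Notation toK := (@FracField.tofrac A).

Lemma open_Zariski_V (F : Fbar A) : open (Zariski_V F).
Proof.
exists [set Zariski_V F]; last by rewrite bigcup_set1.
move=> _ ->; exists [fset Zariski_V F]%fset.
  by move=> _ /fset1P ->; apply: mem_set; exists F.
by rewrite set_fset1 bigcap_set1.
Qed.

Lemma continuous_to_SStar (X : topologicalType) (f : X -> SStar A) :
  (forall F, open (f @^-1` Zariski_V F)) -> continuous f.
Proof.
move=> fV; apply/continuousP => _ [C sC <-].
rewrite preimage_bigcup; apply: bigcup_open => _ /sC[E sE <-].
rewrite preimage_bigcap; apply: open_bigcap_finite => // V VE.
by have := sE V VE; rewrite inE => -[F _ <-]; exact: fV.
Qed.

Lemma open_Zariski_B (F : set K) : finite_set F -> open (@Zariski_B A F).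
Proof.
move=> finF; exists [set Zariski_B F]; last by rewrite bigcup_set1.
by move=> _ ->; exists F.
Qed.

Lemma continuous_to_Over (X : topologicalType) (g : X -> Over A) :
  (forall x : K, open [set t | Over_set (g t) x]) -> continuous g.
Proof.
move=> gx; apply/continuousP => _ [C sC <-].
rewrite preimage_bigcup; apply: bigcup_open => _ /sC[F finF <-].
exact: (open_bigcap_finite finF (fun x _ => gx x)).
Qed.

Lemma Over0 (D : Over A) : Over_set D 0.
Proof. by rewrite -(rmorph0 toK); exact: Over_base. Qed.

Lemma Over_sum (D : Over A) n (d : 'I_n -> K) :
  (forall i, Over_set D (d i)) -> Over_set D (\sum_(i < n) d i).
Proof.
move=> Dd; elim/big_ind: _ => [|x y Dx Dy|//]; first exact: Over0.
rewrite -[y]opprK -[- y]add0r.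
by apply: Over_sub => //; apply: Over_sub => //; exact: Over0.
Qed.

Definition principal_set (k : K) : set K := [set toK a * k | a in setT].

Lemma principal_submodule k : submodule (principal_set k).
Proof.
split=> [|_ _ [a _ <-] [b _ <-]|c _ [a _ <-]].
- by exists 0; rewrite // rmorph0 mul0r.
- by exists (a + b); rewrite // rmorphD mulrDl.
- by exists (c * a); rewrite // rmorphM mulrA.
Qed.

Lemma principal_mem k : principal_set k k.
Proof. by exists 1; rewrite // rmorph1 mul1r. Qed.

Definition principal (k : K) (k0 : k != 0) : Fbar A :=
  MkFbar (principal_submodule k) (ex_intro2 _ _ k (principal_mem k) k0).

(** Multiplying by x turns an expression of 1 as a sum of terms (a x^-1) d into
    an expression of x as a sum of terms a d, each of which lies in D. *)
Lemma wedge_principalV (D : Over A) x (x0 : x^-1 != 0) :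
  Zariski_V (principal x0) (wedge D) <-> Over_set D x.
Proof.
have nx : x != 0 by rewrite -invr_eq0.
split=> [[n [f [d [Ff Dd e1]]]]|Dx]; last first.
  by rewrite /Zariski_V /= -(mulVf nx); exact: prod_setM (principal_mem _) Dx.
rewrite -[x]mul1r e1 mulr_suml; apply: Over_sum => i.
have [a _ <-] := Ff i.
by rewrite mulrAC divfK //; apply: Over_mul => //; exact: Over_base.
Qed.

(** Membership of 1 in F D is witnessed by finitely many elements of D, which
    single out a basic open neighbourhood of D. *)
Lemma open_wedge_V (F : Fbar A) : open (@wedge A @^-1` Zariski_V F).
Proof.
rewrite openE => D [n [f [d [Ff Dd e1]]]].
apply: (filterS (P := Zariski_B (range d))).
  by move=> C dC; exists n, f, d; split=> // i; apply: dC; exists i.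
apply: open_nbhs_nbhs; split; last by move=> _ [i _ <-].
exact/open_Zariski_B/finite_image/finite_finset.
Qed.

Lemma wedge_inj : injective (@wedge A).
Proof.
move=> B C eBC; apply: Over_eq; apply/seteqP.
have sub (D E : Over A) : wedge D = wedge E -> Over_set D `<=` Over_set E.
  move=> eDE x Dx; have [->|nx] := eqVneq x 0; first exact: Over0.
  have x0 : x^-1 != 0 by rewrite invr_eq0.
  by apply/(wedge_principalV E x0); rewrite -eDE; exact/wedge_principalV.
by split; exact: sub.
Qed.

End ZariskiTopologies.

Theorem proposition2p5 (A : idomainType) :
  topological_embedding (@phi A : Over A -> SStarf A).
Proof.
split.
  do 2!apply: continuous_to_set_type.
  by apply: continuous_to_SStar => F; exact: open_wedge_V.
pose val2 (y : range (@phi A : Over A -> SStarf A)) : SStar A :=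
  set_val (set_val y).
have val2_continuous : continuous val2.
  by move=> y; apply: continuous_comp; exact: initial_continuous.
have /choice[g gP] (y : range (@phi A : Over A -> SStarf A)) :
    exists D, phi D = set_val y.
  by have [D _ eD] := set_valP y; exists D.
have wedge_g y : wedge (g y) = val2 y by rewrite /val2 -gP.
exists g; split.
- apply: continuous_to_Over => x; have [->|nx] := eqVneq x 0.
    (* Every overring contains 0, for which there is no ideal x^-1 A. *)
    rewrite [X in open X](_ : _ = setT); first exact: openT.
    by apply/seteqP; split=> // y _; exact: Over0.
  have x0 : x^-1 != 0 by rewrite invr_eq0.
  rewrite [X in open X](_ : _ = val2 @^-1` Zariski_V (principal x0)).
    by move/continuousP: val2_continuous; apply; exact: open_Zariski_V.
  apply/seteqP; split=> y.
    by move/(wedge_principalV (g y) x0); rewrite wedge_g.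
  by rewrite /preimage /mkset -wedge_g => /wedge_principalV.
- by move=> D; apply: wedge_inj; rewrite wedge_g.
- by move=> y; apply: val_inj; rewrite /= gP.
Qed.
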